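(* Let $p_1,\dots,p_k$ be distinct primes ($k\ge1$) and let $G=S_{p_1}\times\cdots\times S_{p_k}$ be a finite abelian group with $d(G)=2$, where each $S_{p_i}$ is a non-cyclic abelian $p_i$-group of order $p_i^{u_i}$. The non-zero adjacency eigenvalues of $\Gamma(G)$ are $$\lambda_{E^-}=(-1)^{|E^-|}\,\varphi\!\left(\frac{|G|}{p_1\cdots p_k}\right)\prod_{j\in E^+}p_j,$$ parametrized over all subsets $E^-\subseteq\{1,\ldots,k\}$ with $E^+=\{1,\ldots,k\}\setminus E^-$, each with multiplicity $\prod_{i\in E^-}p_i$ (or $1$ if $E^-$ is empty). The eigenvalue $0$ has multiplicity $|G|-\sigma(p_1\cdots p_k)$.
   Context: The generating graph $\Gamma(G)$ of a group $G$ is the simple graph with vertex set $G$ in which two distinct vertices $x,y$ are adjacent if and only if $\langle x,y\rangle=G$. Adjacency eigenvalues are eigenvalues of its adjacency matrix. $d(G)$ is the minimum size of a generating set of $G$. $\varphi$ is the Euler totient function and $\sigma$ the sum-of-divisors function. Empty products equal $1$. *)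

(* Defs.v *)
From mathcomp Require Import all_boot all_order all_algebra all_fingroup all_solvable.

Set Implicit Arguments.
Unset Strict Implicit.
Unset Printing Implicit Defensive.

Import GRing.Theory.

Definition generating_graph (gT : finGroupType) (G : {group gT}) : rel gT :=
  fun x y => (x != y) && (<<[set x; y]>>%g == G).

(* The graph has vertex set V; the vertices are numbered by enum_val, and e is
   only used on V. *)
Definition adjacency_matrix (F : nzRingType) (T : finType) (V : {set T})
    (e : rel T) : 'M[F]_#|V| :=
  \matrix_(i, j) (e (enum_val i) (enum_val j))%:R%R.

(* Multiplicity as a root of the characteristic polynomial; it is 0 when a is
   not an eigenvalue. *)
Definition eigenvalue_mult (F : fieldType) (n : nat) (A : 'M[F]_n) (a : F) :
    nat :=
  mup a (char_poly A).

(* Only meaningful for n > 0, since divisors 0 is empty. *)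
Definition sum_divisors (n : nat) : nat := \sum_(d <- divisors n) d.

(* Main.v *)
(* Modulo its Frattini subgroup Phi, each S_i is a plane over F_(p_i), and two elements
   generate S_i iff they lie outside Phi and span distinct lines. So on S_i generation
   is a complete multipartite graph with p_i + 1 parts of size c_i = phi(p_i^(u_i-1))
   (plus isolated vertices), which has spectral projections of rank 1 and p_i for the
   eigenvalues p_i c_i and - c_i. Two elements generate G iff their components
   generate every S_i, so the adjacency matrix of G is the Kronecker product of these
   matrices; expanding that product writes it as sum_E lambda_E P_E with orthogonal
   idempotents P_E whose ranks, equal to their traces, are the multiplicities. *)

Require Import Defs.
From mathcomp Require Import all_boot all_order all_algebra all_fingroup all_solvable.
From mathcomp Require Import zify ring.

Set Implicit Arguments.
Unset Strict Implicit.
Unset Printing Implicit Defensive.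

Import Order.TTheory GRing.Theory Num.Theory.

(** * Characteristic polynomials of combinations of orthogonal idempotents *)

Section CharPoly.
Local Open Scope ring_scope.

(** Two block eliminations of the same matrix [M] give the two determinants. Nothing is divided by
    [x], so [x] may be an indeterminate. *)
Lemma det_scalar_sub_mulmxC (R : comNzRingType) m n (x : R)
    (C : 'M[R]_(n, m)) (B : 'M[R]_(m, n)) :
  x ^+ m * \det (x%:M - C *m B) = x ^+ n * \det (x%:M - B *m C).
Proof.
pose M := block_mx 1%:M B C x%:M.
have detM : \det M = \det (x%:M - C *m B).
  have -> : M = block_mx 1%:M 0 C 1%:M *m block_mx 1%:M B 0 (x%:M - C *m B).
    rewrite mulmx_block !(mul1mx, mulmx1, mulmx0, mul0mx, addr0, add0r).
    by rewrite addrC subrK.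
  by rewrite det_mulmx det_lblock det_ublock !det1 !mul1r.
have : M *m block_mx x%:M 0 (- C) 1%:M
     = block_mx (x%:M - B *m C) B 0 x%:M.
  rewrite mulmx_block !(mul1mx, mulmx1, mulmx0, mul0mx, addr0, add0r) mulmxN.
  by rewrite mulmxN mul_mx_scalar mul_scalar_mx subrr.
move/(congr1 determinant).
rewrite det_mulmx det_lblock det_ublock !det_scalar expr1n mulr1 detM.
by rewrite mulrC => ->; rewrite mulrC.
Qed.

Variables (F : fieldType) (n : nat).
Implicit Types (P B : 'M[F]_n) (l a : F).

(** In [P = col_base P *m row_base P] the first factor has a left inverse and the second a right
    inverse; cancelling them in [P *m P = P] leaves the identity. *)
Lemma mulmx_row_col_base P :
  P *m P = P -> row_base P *m col_base P = 1%:M.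
Proof.
move=> PP; have [/row_fullP[K KC] /row_freeP[K' BK']] :=
  (col_base_full P, row_base_free P).
have : (K *m col_base P) *m (row_base P *m col_base P) *m (row_base P *m K')
     = (K *m col_base P) *m (row_base P *m K').
  transitivity
    (K *m (col_base P *m row_base P *m (col_base P *m row_base P)) *m K').
    by rewrite !mulmxA.
  rewrite mulmx_base PP.
  transitivity (K *m (col_base P *m row_base P) *m K').
    by rewrite mulmx_base.
  by rewrite !mulmxA.
by rewrite KC BK' !mul1mx mulmx1.
Qed.

Lemma rank_idempotent P : P *m P = P -> (\rank P)%:R = \tr P.
Proof.
move=> /mulmx_row_col_base BC.
by rewrite -[in RHS](mulmx_base P) mxtrace_mulC BC mxtrace1.
Qed.

Lemma char_poly_scale_idempotent P l : P *m P = P ->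
  'X^(\rank P) * char_poly (l *: P) = 'X^n * ('X - l%:P) ^+ \rank P.
Proof.
move=> /mulmx_row_col_base BC.
rewrite /char_poly /char_poly_mx -{2}(mulmx_base P) scalemxAl map_mxM.
rewrite det_scalar_sub_mulmxC -map_mxM -scalemxAr BC.
by rewrite scalemx1 map_scalar_mx -raddfB det_scalar.
Qed.

(* Up to a scalar factor X, a sum with B P = 0 has a characteristic matrix that
   splits: X (X - B - P) = (X - B) (X - P). *)
Lemma char_polyD_orthogonal B P : B *m P = 0 ->
  'X^n * char_poly (B + P) = char_poly B * char_poly P.
Proof.
move=> BP0; rewrite -[RHS]det_mulmx -det_scalar -[LHS]det_mulmx.
congr (\det _); rewrite /char_poly_mx map_mxD.
rewrite mulmxBl !mulmxBr -map_mxM BP0 map_mx0 subr0 !mul_scalar_mx.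
by rewrite mul_mx_scalar scalerDr opprD addrA addrAC.
Qed.

(** Induction on [r] splits off one idempotent orthogonal to the others. The terms with [a == 0]
    account for the common kernel, of dimension [n] minus the sum of the ranks; placing them on both
    sides avoids truncated subtraction. *)
Lemma mup_char_poly_sum_idempotents (I : eqType) (r : seq I)
    (P : I -> 'M[F]_n) (l : I -> F) a :
    uniq r -> (forall i, P i *m P i = P i) ->
    (forall i j, i != j -> P i *m P j = 0) ->
  (mup a (char_poly (\sum_(i <- r) l i *: P i))
     + (a == 0%R) * \sum_(i <- r) \rank (P i)
   = (a == 0%R) * n + \sum_(i <- r | l i == a) \rank (P i))%N.
Proof.
move=> + PP P0; have mupX m : mup a ('X^m : {poly F}) = ((a == 0%R) * m)%N.
  have := mup_XsubCX m a 0.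
  by rewrite polyC0 subr0 eq_sym => ->; case: eqP; rewrite ?mul1n ?mul0n.
have cp0 (M : 'M[F]_n) : char_poly M != 0 by rewrite monic_neq0 ?char_poly_monic.
have X0 m : ('X^m : {poly F}) != 0 by rewrite monic_neq0 ?monicXn.
elim: r => [|i r IHr] /= => [_|/andP[r'i /IHr{}IHr]].
  rewrite !big_nil muln0 !addn0 /char_poly /char_poly_mx map_mx0 subr0.
  by rewrite det_scalar mupX.
rewrite !big_cons; set B := \sum_(j <- r) _ in IHr *; set Q := l i *: P i.
have B0 : B *m Q = 0.
  rewrite mulmx_suml big_seq big1 // => j rj.
  rewrite -scalemxAl -scalemxAr P0 ?scaler0 //.
  by apply: contraNneq r'i => <-.
have := congr1 (mup a) (char_polyD_orthogonal B0).
rewrite !mupM ?X0 ?cp0 // addrC mupX => e1.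
have := congr1 (mup a) (char_poly_scale_idempotent (l i) (PP i)).
have Xl0 : ('X - (l i)%:P) ^+ \rank (P i) != 0 :> {poly F}.
  by rewrite monic_neq0 // monic_exp // monicXsubC.
rewrite !mupM ?X0 ?cp0 // !mupX mup_XsubCX => e2.
move: e1 e2 IHr.
move: (mup a (char_poly (Q + B))) (mup a (char_poly Q)) (mup a (char_poly B)).
move: (\rank (P i)) (\sum_(j <- r) \rank (P j))%N.
move: (\sum_(j <- r | l j == a) \rank (P j))%N.
by case: (a == 0); case: (l i == a) => *; lia.
Qed.
End CharPoly.

Lemma root_mup (F : fieldType) (q : {poly F}) x :
  q != 0%R -> root q x = (0 < mup x q).
Proof. by move=> q0; rewrite -XsubC_dvd // root_factor_theorem. Qed.

(** * Arithmetic functions of products of primes *)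

(** The divisors of [p * m] are those of [m] and their products with [p]; the two lists are disjoint
    because [p] does not divide [m]. *)
Lemma sum_divisors_mul_prime p m : prime p -> coprime p m -> 0 < m ->
  sum_divisors (p * m) = p.+1 * sum_divisors m.
Proof.
move=> pr_p co_pm m_gt0; have p_gt0 := prime_gt0 pr_p.
rewrite /sum_divisors mulSn [p * \sum_(_ <- _) _]big_distrr /=.
rewrite -(big_map (muln p) xpredT id) -big_cat.
apply: perm_big; apply: uniq_perm; rewrite ?divisors_uniq //.
  rewrite cat_uniq divisors_uniq map_inj_uniq ?divisors_uniq ?andbT /=.
    apply/hasPn => _ /mapP[d _ ->] /=.
    rewrite -dvdn_divisors //; apply/negP => /(dvdn_trans (dvdn_mulr d (dvdnn p))).
    by apply/negP; rewrite -prime_coprime.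
  by move=> a b /eqP; rewrite eqn_pmul2l // => /eqP.
move=> d; rewrite mem_cat -!dvdn_divisors ?muln_gt0 ?p_gt0 //.
apply/idP/orP => [dpm|[dm|/mapP[e e_m ->]]]; last first.
- by rewrite dvdn_pmul2l // dvdn_divisors.
- exact: dvdn_mull.
have [/dvdnP[e de]|ndp] := boolP (p %| d).
  right; apply/mapP; exists e; rewrite ?de 1?mulnC //.
  by rewrite -dvdn_divisors // -(dvdn_pmul2l p_gt0) mulnC -de.
left; rewrite -(Gauss_dvdr _ (_ : coprime d p)) //.
by rewrite coprime_sym prime_coprime.
Qed.

Lemma coprime_prodr (I : eqType) (r : seq I) (m : I -> nat) n :
  {in r, forall i, coprime n (m i)} -> coprime n (\prod_(i <- r) m i).
Proof.
move=> co_n; rewrite big_seq; elim/big_ind: _ => // [|a b na nb].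
  exact: coprimen1.
by rewrite coprimeMr na.
Qed.

Section PairwiseCoprime.
Variables (I : eqType) (r : seq I).
Hypothesis r_uniq : uniq r.

Lemma sum_divisors_prod_primes (p : I -> nat) :
    (forall i, prime (p i)) -> injective p ->
  sum_divisors (\prod_(i <- r) p i) = \prod_(i <- r) (p i).+1.
Proof.
move=> pr_p inj_p; elim: r r_uniq => [|i s IHs] /= => [_|/andP[s'i /IHs{}IHs]].
  by rewrite !big_nil /sum_divisors big_cons big_nil.
rewrite !big_cons sum_divisors_mul_prime ?IHs //; last first.
  by rewrite prodn_gt0 // => j; rewrite prime_gt0.
apply: coprime_prodr => j sj.
by rewrite prime_coprime // dvdn_prime2 //; apply: contraNneq s'i => /inj_p ->.
Qed.

Lemma totient_prod_coprime (m : I -> nat) :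
    (forall i j, i != j -> coprime (m i) (m j)) ->
  totient (\prod_(i <- r) m i) = \prod_(i <- r) totient (m i).
Proof.
move=> co_m; elim: r r_uniq => [|i s IHs] /= => [_|/andP[s'i /IHs{}IHs]].
  by rewrite !big_nil.
rewrite !big_cons totient_coprime ?IHs //.
apply: coprime_prodr => j sj; apply: co_m.
by apply: contraNneq s'i => ->.
Qed.
End PairwiseCoprime.

(** Makes a set of indices recoverable from the product of its primes; the distinctness of the
    eigenvalues rests on this. *)
Lemma dvdn_prod_primes (I : finType) (p : I -> nat) (B : {set I}) i :
    (forall j, prime (p j)) -> injective p ->
  (p i %| \prod_(j in B) p j) = (i \in B).
Proof.
move=> pr_p inj_p; apply/idP/idP => [|Bi]; last by rewrite (bigD1 i) //= dvdn_mulr.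
rewrite Euclid_dvd_prod // big_orE => /existsP[j /andP[Bj]].
by rewrite dvdn_prime2 // => /eqP/inj_p->.
Qed.

(** * Generation of a p-group modulo its Frattini subgroup *)

Section FrattiniLines.
Local Open Scope group_scope.
Variables (gT : finGroupType) (S : {group gT}) (p u : nat).
Hypotheses (pr_p : prime p) (pS : p.-group S) (cardS : #|S| = (p ^ u)%N).
Hypotheses (ncS : ~~ cyclic S).

(* For x outside the Frattini subgroup Phi, this is the preimage in S of the line of
   S / Phi spanned by the image of x. *)
Definition Phi_line (x : gT) : {group gT} := ('Phi(S) <*> [set x])%G.

(** Frattini elements are non-generators: otherwise [x] alone would generate [S]. *)
Lemma Phi_line_neq x : Phi_line x :!=: S.
Proof.
apply: contra ncS => /eqP /Phi_nongen defS.
by apply/cyclicP; exists x.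
Qed.

Lemma Phi_line_id x : x \in Phi_line x.
Proof. by rewrite (subsetP (joing_subr _ _)) ?set11. Qed.

Lemma Phi_sub_line x : 'Phi(S) \subset Phi_line x.
Proof. exact: joing_subl. Qed.

Lemma Phi_line_sub x : x \in S -> Phi_line x \subset S.
Proof. by move=> Sx; rewrite join_subG Phi_sub sub1set. Qed.

Lemma Phi_line_min (K : {group gT}) x :
  'Phi(S) \subset K -> x \in K -> Phi_line x \subset K.
Proof. by move=> PhiK Kx; rewrite join_subG PhiK sub1set. Qed.

Let nPhiS : S \subset 'N('Phi(S)). Proof. exact: gFnorm. Qed.

Lemma card_Phi_line x :
  x \in S -> x \notin 'Phi(S) -> #|Phi_line x| = (p * #|'Phi(S)|)%N.
Proof.
move=> Sx nPhix; have Nx := subsetP nPhiS x Sx.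
have nPhiL : Phi_line x \subset 'N('Phi(S)).
  exact: subset_trans (Phi_line_sub Sx) nPhiS.
rewrite -(Lagrange (Phi_sub_line x)) -card_quotient // mulnC; congr (_ * _)%N.
have -> : Phi_line x / 'Phi(S) = <[coset 'Phi(S) x]>.
  rewrite -quotient_cycle // /= -[in RHS]quotientYidl ?cycle_subG //.
  by rewrite /= joing_idr.
rewrite -orderE (abelem_order_p (Phi_quotient_abelem pS)) ?mem_quotient //.
by apply: contra nPhix => /eqP /coset_idr ->.
Qed.

Hypothesis gen2 : exists x y, <<[set x; y]>> = S.

(** The quotient by ['Phi(S)] is elementary abelian. Two generators bound its order by [p ^ 2], and
    a line, being proper in [S], forces the order above [p]. *)
Lemma card_Phi_quotient : #|S| = (p ^ 2 * #|'Phi(S)|)%N.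
Proof.
have ntS : S :!=: 1 by apply: contraNneq ncS => ->; apply: cyclic1.
have /properP[_ [x Sx nPhix]] := Phi_proper ntS.
have abelQ := Phi_quotient_abelem pS.
have /p_natP[m cQ] := quotient_pgroup 'Phi(S) pS.
rewrite -(Lagrange (Phi_sub S)) -card_quotient // mulnC; congr (_ * _)%N.
have leQ : (#|S / 'Phi(S)| <= p ^ 2)%N.
  have [y [z defS]] := gen2.
  have [Sy Sz] : y \in S /\ z \in S by rewrite -defS !mem_gen ?set21 ?set22.
  have cle w : w \in S -> (#|<[coset 'Phi(S) w]>| <= p)%N.
    move=> Sw; apply: dvdn_leq; first exact: prime_gt0.
    rewrite -orderE order_dvdn.
    by have /(abelemP pr_p)[_ ->] := abelQ; rewrite ?mem_quotient.
  have -> : S / 'Phi(S) = <[coset 'Phi(S) y]> <*> <[coset 'Phi(S) z]>.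
    transitivity (<<[set y; z]>> / 'Phi(S)); first by rewrite defS.
    rewrite quotient_gen.
      rewrite /quotient morphimU !morphim_set1 ?(subsetP nPhiS) //.
      by rewrite joing_idl joing_idr.
    by rewrite subUset !sub1set !(subsetP nPhiS).
  rewrite cent_joinEl ?cycle_abelian; last first.
    by rewrite (sub_abelian_cent2 (abelem_abelian abelQ)) ?cycle_subG ?mem_quotient.
  apply: leq_trans (_ : #|<[coset 'Phi(S) y]>| * #|<[coset 'Phi(S) z]>| <= _)%N.
    by rewrite mul_cardG leq_pmulr ?cardG_gt0.
  by rewrite expnS expn1 leq_mul ?cle.
have : (p < #|S / 'Phi(S)|)%N.
  have := proper_card (_ : Phi_line x \proper S).
  rewrite properEneq Phi_line_neq Phi_line_sub // => /(_ isT).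
  rewrite card_Phi_line // -(Lagrange (Phi_sub S)) -card_quotient // mulnC.
  by rewrite ltn_pmul2l ?cardG_gt0.
rewrite cQ => m_gt1; have {}m_gt1 : (1 < m)%N.
  by rewrite -(ltn_exp2l _ _ (prime_gt1 pr_p)) expn1.
move: leQ; rewrite cQ leq_exp2l ?prime_gt1 // => m_le2.
by congr (p ^ _)%N; apply/eqP; rewrite eqn_leq m_le2.
Qed.

Lemma eq_Phi_line x y : x \in S -> x \notin 'Phi(S) -> y \notin 'Phi(S) ->
  (Phi_line y :==: Phi_line x) = (y \in Phi_line x).
Proof.
move=> Sx nPhix nPhiy; apply/eqP/idP => [<-|xy]; first exact: Phi_line_id.
have Sy := subsetP (Phi_line_sub Sx) y xy.
apply/eqP; rewrite eqEcard Phi_line_min ?Phi_sub_line //.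
by rewrite !card_Phi_line /=.
Qed.

Lemma gen2_Phi_line x y : x \in S -> y \in S ->
  (<<[set x; y]>> == S) =
  [&& x \in S :\: 'Phi(S), y \in S :\: 'Phi(S) & Phi_line x :!=: Phi_line y].
Proof.
move=> Sx Sy; rewrite !inE Sx Sy !andbT.
have notgen (z : gT) :
    z \in S -> x \in Phi_line z -> y \in Phi_line z -> <<[set x; y]>> != S.
  move=> Sz xz yz; apply: contra (Phi_line_neq z) => /eqP defS.
  rewrite eqEsubset Phi_line_sub //=.
  by rewrite -{1}defS gen_subG subUset !sub1set xz.
have [Phix|nPhix] /= := boolP (x \in 'Phi(S)).
  apply: negbTE; apply: (notgen y); rewrite ?Phi_line_id //.
  exact: subsetP (Phi_sub_line y) x Phix.
have [Phiy|nPhiy] /= := boolP (y \in 'Phi(S)).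
  apply: negbTE; apply: (notgen x); rewrite ?Phi_line_id //.
  exact: subsetP (Phi_sub_line x) y Phiy.
have -> : (Phi_line x :!=: Phi_line y) = (y \notin Phi_line x).
  by rewrite eq_sym eq_Phi_line.
have [xy|nxy] /= := boolP (y \in Phi_line x).
  by apply: negbTE; apply: (notgen x); rewrite ?Phi_line_id.
apply/eqP; apply: Phi_nongen; apply/eqP.
set K := ('Phi(S) <*> [set x; y])%G; rewrite -[_ <*> _]/(gval K).
have sKS : K \subset S by rewrite join_subG Phi_sub subUset !sub1set Sx.
have Kx : x \in K by rewrite (subsetP (joing_subr _ _)) ?set21.
have Ky : y \in K by rewrite (subsetP (joing_subr _ _)) ?set22.
have sLK : Phi_line x \proper K.
  rewrite properE Phi_line_min ?joing_subl //=.
  by apply: contra nxy => /subsetP->.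
rewrite eqEcard sKS /= card_Phi_quotient.
have := proper_card sLK; have /dvdnP[m cK] := cardSg (proper_sub sLK).
rewrite cK card_Phi_line // => mgt1.
have m1 : (1 < m)%N.
  by case: m {cK} mgt1 => [|[|m]] //; rewrite ?mul1n ?ltnn.
(* The index [m] of the line in [K] is a power of [p] greater than 1, so [K] has at least
   [p ^ 2 * #|'Phi(S)|] elements. *)
have pm : p %| m.
  have : m %| #|S|.
    by apply: dvdn_trans (cardSg sKS); rewrite cK dvdn_mulr.
  rewrite cardS; case/(dvdn_pfactor _ _ pr_p) => e _ def_m.
  move: m1; rewrite def_m; case: e {def_m} => // e _.
  by rewrite expnS dvdn_mulr.
rewrite expnS expn1 -mulnA leq_mul2r dvdn_leq ?orbT //.
exact: ltnW.
Qed.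

(** As ['Phi(S)] has order [p ^ (u - 2)], the totient equals [(p - 1) * #|'Phi(S)|], the size of a
    line without ['Phi(S)]; and [p ^ 2 - 1 = (p + 1) * (p - 1)]. *)
Lemma card_Phi_compl :
  (#|S :\: 'Phi(S)| = p.+1 * totient (p ^ u.-1))%N /\
  {in S :\: 'Phi(S), forall x,
    #|[set y in S :\: 'Phi(S) | Phi_line x :==: Phi_line y]|
      = totient (p ^ u.-1)}.
Proof.
have p_gt0 := prime_gt0 pr_p.
have cPhi : totient (p ^ u.-1) = (p.-1 * #|'Phi(S)|)%N.
  have := cardS; rewrite card_Phi_quotient => cS.
  have : (2 <= u)%N.
    by rewrite -(leq_exp2l _ _ (prime_gt1 pr_p)) -cS leq_pmulr ?cardG_gt0.
  case: u cS => [|[|e]] //= /eqP.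
  rewrite -[e.+2]addn2 expnD mulnC eqn_pmul2r ?expn_gt0 ?p_gt0 // => /eqP-> _.
  by rewrite totient_pfactor.
split=> [|x /setDP[Sx nPhix]].
  rewrite cardsD (setIidPr (Phi_sub S)) card_Phi_quotient cPhi.
  by move: #|'Phi(S)| => m; case: p p_gt0 => // q _; nia.
transitivity #|Phi_line x :\: 'Phi(S)|.
  apply: eq_card => y; rewrite !inE.
  have [|nPhiy] //= := boolP (y \in 'Phi(S)).
  rewrite eq_sym eq_Phi_line //; apply: andb_idl.
  exact: subsetP (Phi_line_sub Sx) y.
rewrite cardsD (setIidPr (Phi_sub_line x)) card_Phi_line // cPhi.
by case: p p_gt0 => // q _; rewrite mulSn addKn.
Qed.
End FrattiniLines.

(** * Complete multipartite graphs *)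

Section MultipartiteProjections.
Local Open Scope ring_scope.
Variables (F : numFieldType) (T U : finType) (S V : {set T}) (part : T -> U).
Variables (q c : nat).
Hypotheses (sVS : V \subset S) (c_gt0 : (0 < c)%N) (cardV : #|V| = (q.+1 * c)%N).
Hypothesis card_part :
  {in V, forall x, #|[set y in V | part x == part y]| = c}.

Definition mean_kernel (x y : T) : F :=
  ((x \in V) && (y \in V))%:R / #|V|%:R.

(** Projection onto the functions supported on [V] and constant on each part, when all parts have
    [c] elements. *)
Definition part_kernel (x y : T) : F :=
  [&& x \in V, y \in V & part x == part y]%:R / c%:R.

(* The complete multipartite graph on V with q + 1 parts of size c has spectral
   projections mean_kernel, for the eigenvalue q c, and part_kernel - mean_kernel,
   for the eigenvalue - c. *)
Definition spectral_kernel (b : bool) (x y : T) : F :=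
  if b then part_kernel x y - mean_kernel x y else mean_kernel x y.

Let V0 : #|V|%:R != 0 :> F.
Proof. by rewrite pnatr_eq0 -lt0n cardV muln_gt0. Qed.
Let c0 : c%:R != 0 :> F. Proof. by rewrite pnatr_eq0 -lt0n. Qed.

(** The adjacency kernel is [#|V|] times the mean kernel minus [c] times the part kernel;
    substituting [#|V| = (q + 1) * c] regroups it. *)
Lemma multipartite_kernelE x y :
  [&& x \in V, y \in V & part x != part y]%:R
    = - c%:R * spectral_kernel true x y + c%:R * q%:R * spectral_kernel false x y.
Proof.
rewrite /spectral_kernel /part_kernel /mean_kernel cardV natrM.
have q0 : q.+1%:R != 0 :> F by rewrite pnatr_eq0.
rewrite -addn1 natrD in q0 *.
case: (x \in V); case: (y \in V); case: (part x == part y) => /=; field.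
all: by rewrite c0.
Qed.

Let sum_V (f : T -> F) : (forall y, y \notin V -> f y = 0) ->
  \sum_(y in S) f y = \sum_(y in V) f y.
Proof.
move=> f0; rewrite (big_setID V) /= (setIidPr sVS) addrC big1 ?add0r //.
by move=> y /setDP[_ /f0].
Qed.

Lemma conv_mean_mean x z :
  \sum_(y in S) mean_kernel x y * mean_kernel y z = mean_kernel x z.
Proof.
rewrite sum_V => [|y nVy]; last by rewrite /mean_kernel (negbTE nVy) andbF !mul0r.
rewrite (eq_bigr (fun=> mean_kernel x z / #|V|%:R)) => [|y Vy].
  by rewrite sumr_const -[LHS]mulr_natr mulfVK.
by rewrite /mean_kernel Vy andbT; case: (x \in V); case: (z \in V);
   rewrite /= ?(mul0r, mul1r, mulr0).
Qed.

Lemma conv_mean_part x z :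
  \sum_(y in S) mean_kernel x y * part_kernel y z = mean_kernel x z.
Proof.
rewrite sum_V => [|y nVy]; last by rewrite /mean_kernel (negbTE nVy) andbF !mul0r.
have [Vz|nVz] := boolP (z \in V); last first.
  rewrite big1 /mean_kernel => [|y _]; last first.
    by rewrite /part_kernel (negbTE nVz) andbF mul0r mulr0.
  by rewrite (negbTE nVz) andbF mul0r.
transitivity (\sum_(y in [set y in V | part z == part y]) mean_kernel x z / c%:R).
  rewrite [RHS](eq_bigl (fun y => (y \in V) && (part z == part y))) => [|y].
    2: by rewrite inE.
  rewrite [RHS]big_mkcondr; apply: eq_bigr => y Vy.
  rewrite /mean_kernel /part_kernel Vy Vz !andbT /= [part y == _]eq_sym.
  by case: eqP => _; rewrite ?mul1r ?mul0r ?mulr0.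
by rewrite sumr_const card_part // -[LHS]mulr_natr mulfVK.
Qed.

Let mean_kernelC x y : mean_kernel x y = mean_kernel y x.
Proof. by rewrite /mean_kernel andbC. Qed.

Let part_kernelC x y : part_kernel x y = part_kernel y x.
Proof. by rewrite /part_kernel andbCA eq_sym. Qed.

Lemma conv_part_mean x z :
  \sum_(y in S) part_kernel x y * mean_kernel y z = mean_kernel x z.
Proof.
rewrite mean_kernelC -conv_mean_part; apply: eq_bigr => y _.
by rewrite mulrC mean_kernelC part_kernelC.
Qed.

Lemma conv_part_part x z :
  \sum_(y in S) part_kernel x y * part_kernel y z = part_kernel x z.
Proof.
rewrite sum_V => [|y nVy]; last first.
  by rewrite /part_kernel (negbTE nVy) andbF !mul0r.
have [Vx|nVx] := boolP (x \in V); last first.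
  by rewrite big1 /part_kernel (negbTE nVx) ?mul0r // => y _; rewrite !mul0r.
transitivity (\sum_(y in [set y in V | part x == part y]) part_kernel x z / c%:R).
  rewrite [RHS](eq_bigl (fun y => (y \in V) && (part x == part y))) => [|y].
    2: by rewrite inE.
  rewrite [RHS]big_mkcondr; apply: eq_bigr => y Vy.
  rewrite /part_kernel Vx Vy /=; case: eqP => [<-|_]; last by rewrite !mul0r.
  by rewrite mul1r mulrC.
by rewrite sumr_const card_part // -[LHS]mulr_natr mulfVK.
Qed.

(** The mean kernel absorbs the part kernel on both sides, so the difference of these two
    idempotents is idempotent and orthogonal to the mean. *)
Lemma conv_spectral_kernel b b' x z :
  \sum_(y in S) spectral_kernel b x y * spectral_kernel b' y z
    = (b == b')%:R * spectral_kernel b x z.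
Proof.
case: b; case: b' => /=; rewrite ?mul0r ?mul1r.
- transitivity (\sum_(y in S) (part_kernel x y * part_kernel y z
     - part_kernel x y * mean_kernel y z - mean_kernel x y * part_kernel y z
     + mean_kernel x y * mean_kernel y z)).
    by apply: eq_bigr => y _; ring.
  rewrite big_split !sumrB /= conv_part_part conv_part_mean conv_mean_part.
  by rewrite conv_mean_mean; ring.
- under eq_bigr do rewrite mulrBl.
  by rewrite sumrB conv_part_mean conv_mean_mean subrr.
- under eq_bigr do rewrite mulrBr.
  by rewrite sumrB conv_mean_part conv_mean_mean subrr.
- exact: conv_mean_mean.
Qed.

(** The part kernel has trace [q + 1], the number of parts, and the mean kernel has trace 1. *)
Lemma trace_spectral_kernel b :
  \sum_(x in S) spectral_kernel b x x = (if b then q else 1)%:R.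
Proof.
have trm : \sum_(x in S) mean_kernel x x = 1.
  rewrite sum_V => [|y nVy]; last by rewrite /mean_kernel (negbTE nVy) mul0r.
  rewrite (eq_bigr (fun=> #|V|%:R^-1)) => [|x Vx].
    by rewrite sumr_const -[LHS]mulr_natr mulVf.
  by rewrite /mean_kernel Vx mul1r.
case: b => //=; rewrite sumrB trm.
rewrite sum_V => [|y nVy]; last by rewrite /part_kernel (negbTE nVy) mul0r.
rewrite (eq_bigr (fun=> c%:R^-1)) => [|x Vx].
  rewrite sumr_const -[c%:R^-1 *+ _]mulr_natr cardV natrM mulrCA mulVf // mulr1.
  by rewrite -addn1 natrD addrK.
by rewrite /part_kernel Vx eqxx mul1r.
Qed.
End MultipartiteProjections.

(** * Primary components of an abelian group *)

Lemma prodr_forall (R : comPzSemiRingType) (I : finType) (b : pred I) :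
  (\prod_i (b i)%:R = [forall i, b i]%:R :> R)%R.
Proof.
case: forallP => [bT|/forallP]; first by rewrite big1 // => i _; rewrite bT.
by rewrite negb_forall => /existsP[i nbi]; rewrite (bigD1 i) //= (negbTE nbi) mul0r.
Qed.

Section PrimaryDecomposition.
Local Open Scope group_scope.
Variables (gT : finGroupType) (G : {group gT}) (I : finType) (p : I -> nat).
Variable (S : I -> {group gT}).
Hypothesis p_inj : injective p.
Hypotheses (G_abelian : abelian G) (G_dprod : \big[dprod/1]_i S i = G).
Hypothesis S_pgroup : forall i, (p i).-group (S i).

Lemma bigdprod_sub i : S i \subset G.
Proof. by rewrite -(bigdprodWY G_dprod) sub_gen // (bigcup_max i). Qed.

Lemma prod_components_in (f : I -> gT) :
  (forall i, f i \in S i) -> \prod_i f i \in G.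
Proof. by move=> Sf; apply: group_prod => i _; apply: subsetP (bigdprod_sub i) _ _. Qed.

(** Components of the direct product are encoded as constituents. Taking [p j]-parts is
    multiplicative on an abelian group, fixes [f j], and kills every other [f i] by injectivity of
    [p]. *)
Lemma constt_prod_components (f : I -> gT) j :
  (forall i, f i \in S i) -> (\prod_i f i).`_(p j) = f j.
Proof.
move=> Sf; have fG i := subsetP (bigdprod_sub i) _ (Sf i).
have -> : (\prod_i f i).`_(p j) = \prod_i (f i).`_(p j).
  suff [] : \prod_i f i \in G /\ (\prod_i f i).`_(p j) = \prod_i (f i).`_(p j) by [].
  elim/big_rec2: _ => [|i y x _ [Gx <-]]; first by rewrite constt1.
  split; first exact: groupM.
  by rewrite consttM //; apply: (centsP G_abelian).
rewrite -[RHS](big_pred1_eq mulg j f) [RHS]big_mkcond.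
apply: eq_bigr => i _; have fi := mem_p_elt (S_pgroup i) (Sf i).
have [<-|nij] := eqVneq i j; first exact: constt_p_elt.
apply/constt1P/(sub_p_elt _ fi) => _ /eqnP->.
by rewrite !inE; apply: contraNneq nij => /p_inj->.
Qed.

Lemma constt_components x : x \in G ->
  (forall i, x.`_(p i) \in S i) /\ \prod_i x.`_(p i) = x.
Proof.
move=> Gx; have [c [Sc def_x _]] := mem_bigdprod G_dprod Gx.
have {}Sc i : c i \in S i by apply: Sc.
have xc i : x.`_(p i) = c i by rewrite def_x constt_prod_components.
by split=> [i|]; rewrite ?xc // [RHS]def_x; apply: eq_bigr.
Qed.

(** Distributivity, reindexed by the bijection between [G] and the families with [f i \in S i],
    whose inverse takes constituents. *)
Lemma sum_prod_components (R : comPzSemiRingType) (h : I -> gT -> R) :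
  (\sum_(x in G) \prod_i h i x.`_(p i) = \prod_i \sum_(y in S i) h i y)%R.
Proof.
rewrite bigA_distr_big_dep /=.
rewrite (reindex_onto (fun f : {ffun I -> gT} => \prod_i f i)
  (fun x => [ffun i => x.`_(p i)])) /= => [|x /constt_components[_ {2}<-]]; last first.
  by apply: eq_bigr => i _; rewrite ffunE.
apply: eq_big => [f|f /andP[_ /eqP fE]].
  apply/andP/familyP => [[/constt_components[Sf _] /eqP <-] i | Sf].
    by rewrite ffunE.
  split; first exact: prod_components_in.
  by apply/eqP/ffunP => i; rewrite ffunE constt_prod_components.
by apply: eq_bigr => i _; rewrite -[in RHS]fE ffunE.
Qed.

(** Constituents are powers, so if those of [x] and [y] generate every [S i], then [x] and [y]
    generate [G]. Conversely, taking [p i]-parts is a morphism from [G] onto [S i] and preserves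
    generation. *)
Lemma gen2_components x y : x \in G -> y \in G ->
  (<<[set x; y]>> == G) = [forall i, <<[set x.`_(p i); y.`_(p i)]>> == S i].
Proof.
move=> Gx Gy; apply/eqP/forallP => [genG i | genS]; last first.
  apply/eqP; rewrite eqEsubset gen_subG subUset !sub1set Gx Gy /=.
  rewrite -(bigdprodWY G_dprod) gen_subG; apply/bigcupsP => i _.
  rewrite -(eqP (genS i)) gen_subG subUset !sub1set.
  by rewrite !groupX ?mem_gen ?set21 ?set22.
have fM : {in G &, {morph (fun z => z.`_(p i)) : a b / a * b}}.
  by move=> a b Ga Gb; rewrite consttM //; apply: (centsP G_abelian).
pose f := Morphism fM.
have <- : f @* G = S i.
  apply/setP => z; apply/morphimP/idP => [[w _ Gw ->]|Sz].
    by have [/(_ i)] := constt_components Gw.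
  have Gz := subsetP (bigdprod_sub i) z Sz.
  by exists z => //=; rewrite constt_p_elt // (mem_p_elt (S_pgroup i)).
rewrite -(congr1 (fun A : {set gT} => f @* A) genG).
rewrite morphim_gen ?subUset ?sub1set ?Gx //.
by rewrite morphimU !morphim_set1.
Qed.

(* The Kronecker product of the kernels f i, for the identification of G with the
   product of the S i. *)
Definition tensor_mx (R : comPzSemiRingType) (f : I -> gT -> gT -> R) :
    'M[R]_#|G| :=
  (\matrix_(a, b)
     \prod_i f i ((enum_val a).`_(p i))%g ((enum_val b).`_(p i))%g)%R.

Lemma mul_tensor_mx (R : comPzSemiRingType) (f g : I -> gT -> gT -> R) :
  (tensor_mx f *m tensor_mx g
     = tensor_mx (fun i x z => \sum_(y in S i) f i x y * g i y z))%R.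
Proof.
apply/matrixP => a b; rewrite !mxE -sum_prod_components [RHS]big_enum_val /=.
by apply: eq_bigr => d _; rewrite !mxE big_split.
Qed.

Lemma trace_tensor_mx (R : comPzSemiRingType) (f : I -> gT -> gT -> R) :
  (\tr (tensor_mx f) = \prod_i \sum_(x in S i) f i x x)%R.
Proof.
by rewrite -sum_prod_components big_enum_val; apply: eq_bigr => a _; rewrite mxE.
Qed.
End PrimaryDecomposition.

(** * Spectral decomposition of the generating graph *)

Theorem theorem6p2 (F : numFieldType) (gT : finGroupType) (G : {group gT})
    (k : nat) (p u : 'I_k -> nat) (S : 'I_k -> {group gT})
    (k_gt0 : 0 < k)
    (p_prime : forall i, prime (p i))
    (p_inj : injective p)
    (G_abelian : abelian G)
    (G_rank : 'm(G)%g = 2)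
    (G_dprod : (\big[dprod/1%g]_(i < k) S i)%g = G)
    (S_abelian : forall i, abelian (S i))
    (S_pgroup : forall i, ((p i).-group (S i))%g)
    (S_card : forall i, #|S i| = p i ^ u i)
    (S_noncyclic : forall i, ~~ cyclic (S i)) :
  let A := adjacency_matrix F G (generating_graph G) in
  let lambda (Em : {set 'I_k}) : F :=
    ((-1) ^+ #|Em| * (totient (#|G| %/ \prod_(i < k) p i))%:R
       * \prod_(j in ~: Em) (p j)%:R)%R in
  [/\ forall a : F,
        (eigenvalue A a /\ a <> 0%R) <-> exists Em : {set 'I_k}, a = lambda Em,
      forall Em : {set 'I_k},
        eigenvalue_mult A (lambda Em) = \prod_(i in Em) p i
    & eigenvalue_mult A 0%R = #|G| - sum_divisors (\prod_(i < k) p i)].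
Proof.
move=> A lambda.
pose c i := totient (p i ^ (u i).-1).
pose V i := S i :\: 'Phi(S i)%g.
pose L i (x : gT) : {set gT} := Phi_line (S i) x.
pose K b i : gT -> gT -> F := spectral_kernel F (V i) (L i) (c i) b.
(* An index in [E] selects the projection of rank [p i] for the eigenvalue [- c i], any other index
   the rank-one projection; so [E] plays the role of [Em]. *)
pose P (E : {set 'I_k}) := tensor_mx G p (fun i => K (i \in E) i).
have p_gt0 i : 0 < p i by apply: prime_gt0.
have c_gt0 i : 0 < c i by rewrite totient_gt0 expn_gt0 p_gt0.
have genG := gen2_components p_inj G_abelian G_dprod S_pgroup.
have comp := constt_components p_inj G_abelian G_dprod S_pgroup.
have gen2S i : exists x y, <<[set x; y]>>%g = S i.
  have [B genB cB] := grank_witness G.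
  have /cards2P[x [y [_ defB]]] : #|B| == 2 by rewrite cB G_rank.
  have [Gx Gy] : x \in G /\ y \in G by rewrite -genB defB !mem_gen ?set21 ?set22.
  exists (x.`_(p i))%g, (y.`_(p i))%g; apply/eqP.
  by move: i; apply/forallP; rewrite -genG // -defB genB.
have cV i :=
  card_Phi_compl (p_prime i) (S_pgroup i) (S_card i) (S_noncyclic i) (gen2S i).
have sVS i : V i \subset S i by apply: subsetDl.
have PP E E' : (P E *m P E' = (E == E')%:R *: P E)%R.
  rewrite (mul_tensor_mx p_inj G_abelian G_dprod S_pgroup).
  apply/matrixP => a b; rewrite !mxE.
  under eq_bigr => i _ do
    rewrite (conv_spectral_kernel F (sVS i) (c_gt0 i) (cV i).1 (cV i).2).
  rewrite big_split /=; congr (_ * _)%R.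
  have [->|nEE] := eqVneq E E'; first by rewrite big1 // => i _; rewrite eqxx.
  have [i ni] : exists i, (i \in E) != (i \in E').
    apply/existsP; apply: contraR nEE => /existsPn eqE.
    by apply/eqP/setP => i; apply/eqP/negPn.
  by rewrite (bigD1 i) //= (negbTE ni) mul0r.
(* The trace factors over the components, and characteristic zero recovers the rank from it. *)
have rankP E : \rank (P E) = \prod_(i in E) p i.
  have : ((\rank (P E))%:R = \tr (P E))%R.
    by apply: rank_idempotent; rewrite PP eqxx scale1r.
  rewrite (trace_tensor_mx p_inj G_abelian G_dprod S_pgroup).
  under eq_bigr => i _ do
    rewrite (trace_spectral_kernel F _ (sVS i) (c_gt0 i) (cV i).1).
  rewrite -natr_prod => /eqP; rewrite eqr_nat => /eqP->.
  by rewrite [RHS]big_mkcond.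
have totient_G : totient (#|G| %/ \prod_(i < k) p i) = \prod_i c i.
  have -> : #|G| = \prod_(i < k) p i * \prod_(i < k) p i ^ (u i).-1.
    rewrite -(bigdprod_card G_dprod) -big_split; apply: eq_bigr => i _ /=.
    (* Here [u i] is positive, since a trivial [S i] would be cyclic. *)
    rewrite S_card; case: (u i) (S_card i) => [/card1_trivg S1|e _].
      2: by rewrite expnS.
    by have := S_noncyclic i; rewrite S1 cyclic1.
  rewrite mulKn ?prodn_gt0 // totient_prod_coprime ?index_enum_uniq // => i j nij.
  rewrite coprimeXl // coprimeXr // prime_coprime // dvdn_prime2 //.
  by apply: contraNneq nij => /p_inj->.
have lambdaE E : lambda E
    = (\prod_i (if i \in E then - (c i)%:R else (c i)%:R * (p i)%:R))%R.
  rewrite (eq_bigr (fun i => (c i)%:R * (if i \in E then -1 else (p i)%:R))%R).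
    rewrite big_split /= -natr_prod -totient_G [LHS]mulrAC [LHS]mulrC.
    congr (_ * _)%R; rewrite [RHS](bigID (mem E)) /=; congr (_ * _)%R.
      by rewrite -prodr_const; apply: eq_bigr => i ->.
    rewrite (eq_bigl (fun i => i \notin E)) => [|i]; last by rewrite inE.
    by apply: eq_bigr => i /negbTE->.
  by move=> i _; case: ifP; rewrite ?mulrN1.
have A_sum : A = (\sum_(E <- index_enum {set 'I_k}) lambda E *: P E)%R.
  apply/matrixP => a b; rewrite summxE mxE.
  have [Gx Gy] := (enum_valP a, enum_valP b).
  set x := enum_val a in Gx *; set y := enum_val b in Gy *.
  have -> : generating_graph G x y = [forall i,
      <<[set (x.`_(p i))%g; (y.`_(p i))%g]>>%g == S i].
    rewrite /generating_graph -genG //.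
    (* Generation forces [x != y]: otherwise the component at index 0, present as [k > 0], would be
       cyclic. *)
    apply: andb_idl; rewrite genG // => /forallP/(_ (Ordinal k_gt0))/eqP defS.
    apply: contraNneq (S_noncyclic (Ordinal k_gt0)) => eq_xy.
    by rewrite -defS eq_xy setUid cycle_cyclic.
  rewrite -prodr_forall.
  transitivity (\prod_i (- (c i)%:R * K true i (x.`_(p i))%g (y.`_(p i))%g
      + (c i)%:R * (p i)%:R * K false i (x.`_(p i))%g (y.`_(p i))%g) : F)%R.
    apply: eq_bigr => i _.
    have [[/(_ i) Sx _] [/(_ i) Sy _]] := (comp _ Gx, comp _ Gy).
    rewrite (gen2_Phi_line (p_prime i) (S_pgroup i) (S_card i)) //.
    exact: (multipartite_kernelE F (L i) (c_gt0 i) (cV i).1).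
  (* Expanding the product of two-term sums, [E] records the indices where the first term is
     chosen. *)
  rewrite bigA_distr; apply: eq_bigr => E _.
  rewrite !mxE lambdaE -big_split; apply: eq_bigr => i _.
  by rewrite -/x -/y; case: (i \in E).
have mupA (a : F) :
    eigenvalue_mult A a + (a == 0%R) * \sum_(E : {set 'I_k}) \prod_(i in E) p i
  = (a == 0%R) * #|G| + \sum_(E | lambda E == a) \prod_(i in E) p i.
  have PPid E : (P E *m P E = P E)%R by rewrite PP eqxx scale1r.
  have PP0 E E' : E != E' -> (P E *m P E' = 0)%R.
    by move=> /negbTE nE; rewrite PP nE scale0r.
  have := mup_char_poly_sum_idempotents lambda a (index_enum_uniq _) PPid PP0.
  rewrite -A_sum; under eq_bigr do rewrite rankP.
  by under [in RHS]eq_bigr do rewrite rankP.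
have lambda_neq0 E : (lambda E != 0)%R.
  rewrite lambdaE; apply/prodf_neq0 => i _.
  by case: ifP => _; rewrite ?oppr_eq0 ?mulf_neq0 // pnatr_eq0 -lt0n.
(* The absolute value removes the sign and leaves, up to a constant factor, the product of the
   primes outside [E], which determines [E]. Hence ranks of different [E] never add up at one
   eigenvalue. *)
have lambda_inj : injective lambda.
  have norm_lambda E : (`|lambda E| =
      (totient (#|G| %/ \prod_(i < k) p i) * \prod_(j in ~: E) p j)%:R)%R.
    rewrite !normrM normrX normrN1 expr1n mul1r normr_nat natrM natr_prod.
    by rewrite normr_prod; congr (_ * _)%R; apply: eq_bigr => j _; rewrite normr_nat.
  move=> E E' /(congr1 Num.norm)/eqP; rewrite !norm_lambda eqr_nat eqn_pmul2l.
    move=> /eqP eq_prod; apply/setP => i; apply: negb_inj.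
    by rewrite -!in_setC -!(dvdn_prod_primes _ _ p_prime p_inj) eq_prod.
  by rewrite totient_G prodn_gt0.
have mup_lambda E : eigenvalue_mult A (lambda E) = \prod_(i in E) p i.
  have := mupA (lambda E).
  rewrite (negbTE (lambda_neq0 E)) !mul0n addn0 add0n => ->.
  by under eq_bigl do rewrite (inj_eq lambda_inj); rewrite big_pred1_eq.
split=> // [a|].
  rewrite eigenvalue_root_char root_mup; last first.
    by rewrite monic_neq0 ?char_poly_monic.
  rewrite -[mup a _]/(eigenvalue_mult A a).
  split=> [[mup_gt0 /eqP a0]|[E ->]]; last first.
    by split; [rewrite mup_lambda prodn_gt0|apply/eqP].
  (* A non-zero [a] different from every [lambda E] would have multiplicity 0 by [mupA]. *)
  have [E /eqP <-|noE] := pickP (fun E => lambda E == a); first by exists E.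
  have := mupA a; rewrite (negbTE a0) big_pred0 // !mul0n !addn0 => mup0.
  by rewrite mup0 in mup_gt0.
(* The divisor sum is the product of the [p i + 1], whose expansion over subsets is the sum of all
   ranks. *)
have -> : sum_divisors (\prod_(i < k) p i)
    = \sum_(E : {set 'I_k}) \prod_(i in E) p i.
  rewrite sum_divisors_prod_primes ?index_enum_uniq //.
  under eq_bigr do rewrite -addn1.
  by rewrite bigA_distr; apply: eq_bigr => E _; rewrite [RHS]big_mkcond.
(* No [lambda E] vanishes, so [mupA] at 0 says that the multiplicity plus the total rank is [#|G|],
   and the subtraction is not truncated. *)
have := mupA 0%R; rewrite eqxx !mul1n [X in _ = _ + X]big_pred0 => [|E].
  by rewrite addn0 => cardG; rewrite -[X in _ = X - _]cardG addnK.
exact/negbTE.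
Qed.
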